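(* Let $\mathcal{X}$ be a Polish space with Borel $\sigma$-field $\mathcal{B}$, let $P$ be a Markov operator on $\mathcal{X}$ with transition kernel $p$, and suppose that $P$ admits a unique invariant probability measure $\pi$ and that $\pi$ is reversible for $P$. Suppose there exist a measurable function $V:\mathcal{X}\to[1,\infty)$, real numbers $b<\infty$, $\alpha>0$, $\lambda>0$, a measurable set $K\subseteq\mathcal{X}$, and a probability measure $\nu$ on $(\mathcal{X},\mathcal{B})$ such that $$PV(x)\le (1-\lambda)V(x)+b\,\mathbf{1}_K(x)\quad\text{for all }x\in\mathcal{X},$$ $$P\mathbf{1}_A(x)\ge \alpha\,\nu(A)\,\mathbf{1}_K(x)\quad\text{for all }x\in\mathcal{X},\ A\in\mathcal{B}.$$ Then $P$ satisfies the Poincaré inequality $$\|f\|_{2,\pi}^2\le \frac{1}{\beta_+}\,\langle f,(I-P)f\rangle_\pi\quad\text{for all } f\in L^2_0(\pi),\qquad\text{with}\quad \beta_+=\frac{\lambda}{1+\frac{2b}{\alpha}}.$$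
   Context: A Markov operator $P$ on $\mathcal{X}$ is given by a probability transition kernel $p:\mathcal{X}\times\mathcal{B}\to[0,1]$ via $Pf(x)=\int_{\mathcal{X}} f(y)\,p(x,dy)$ for bounded measurable $f$ (and also for nonnegative measurable $f$). It acts on probability measures by $\mu P(\cdot)=\int_{\mathcal{X}}p(x,\cdot)\,d\mu(x)$. A probability measure $\pi$ is invariant if $\pi P=\pi$; then $P$ is a bounded linear operator on the real space $L^2(\pi)$, which carries the inner product $\langle f,g\rangle_\pi=\int fg\,d\pi$ and norm $\|f\|_{2,\pi}^2=\langle f,f\rangle_\pi$. The invariant measure $\pi$ is reversible if $\langle f,Pg\rangle_\pi=\langle Pf,g\rangle_\pi$ for all $f,g\in L^2(\pi)$. $L^2_0(\pi)=\{f\in L^2(\pi):\int f\,d\pi=0\}$, and $\mathbf{1}_A$ is the indicator function of $A$. *)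

(* Defs.v *)
From HB Require Import structures.
From mathcomp Require Import all_boot all_order all_algebra.
From mathcomp Require Import all_classical all_reals all_analysis.

Set Implicit Arguments.
Unset Strict Implicit.
Unset Printing Implicit Defensive.

Import Order.TTheory GRing.Theory Num.Theory.
Import numFieldNormedType.Exports.

Local Open Scope classical_set_scope.
Local Open Scope ring_scope.

(* A Polish space is a topological notion: the complete metric only has to
   exist, it is not part of the structure of [T]. *)
Section polish.
Context (R : realType) (T : topologicalType).
Implicit Type dist : T -> T -> R.

Definition is_metric dist : Prop :=
  [/\ forall x y, 0 <= dist x y,
      forall x y, dist x y = 0 <-> x = y,
      forall x y, dist x y = dist y x &
      forall x y z, dist x z <= dist x y + dist y z].

Definition metrizes dist : Prop :=
  forall (x : T) (A : set T),
    nbhs x A <-> exists2 e : R, 0 < e & [set y | dist x y < e] `<=` A.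

Definition complete_metric dist : Prop :=
  forall u : nat -> T,
    (forall e : R, 0 < e -> exists N : nat,
       forall m n : nat, (N <= m)%N -> (N <= n)%N -> dist (u m) (u n) < e) ->
    exists l : T, u @ \oo --> l.

Definition separable : Prop := exists2 D : set T, countable D & dense D.

Definition polish : Prop :=
  separable /\
  exists dist, [/\ is_metric dist, metrizes dist & complete_metric dist].

End polish.
Arguments polish R T : clear implicits.

Notation borel X := (g_sigma_algebraType (@open X)).

Section markov_operator.
Context d (T : measurableType d) (R : realType).
Variable p : R.-pker T ~> T.
Implicit Types (mu pi : probability T R) (f g : T -> R).

Definition markov_op_ge0 (f : T -> \bar R) (x : T) : \bar R :=
  (\int[p x]_y f y)%E.

(* For [f] square integrable under an invariant probability [pi], [f] is
   [p x]-integrable for [pi]-almost every [x]; on the remaining null set the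
   value of the real-valued integral is irrelevant. *)
Definition markov_op f (x : T) : R := \int[p x]_y f y.

Definition markov_act mu (A : set T) : \bar R := (\int[mu]_x p x A)%E.

Definition invariant_prob mu : Prop :=
  forall A, measurable A -> markov_act mu A = mu A.

(* Uniqueness is on measurable sets, where measures are determined. *)
Definition unique_invariant pi : Prop :=
  invariant_prob pi /\
  forall mu, invariant_prob mu -> forall A, measurable A -> mu A = pi A.

(* Elements of L^2(pi) are handled through representatives. *)
Definition inner pi f g : R := \int[pi]_x (f x * g x).

Definition normsq pi f : R := inner pi f f.

Definition reversible pi : Prop :=
  forall f g, f \in Lfun pi 2%:E -> g \in Lfun pi 2%:E ->
    inner pi f (markov_op g) = inner pi (markov_op f) g.

Definition L20 pi f : Prop := f \in Lfun pi 2%:E /\ \int[pi]_x f x = 0.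

End markov_operator.

(* Main.v *)
Require Import Defs.
From HB Require Import structures.
From mathcomp Require Import all_boot all_order all_algebra.
From mathcomp Require Import all_classical all_reals all_analysis.
From mathcomp Require Import measurable_realfun ring lra.

(** For a reversible [pi], iterated integrals satisfy [\int u Pv = \int v Pu]
    for nonnegative [u] and [v]. With [v = V] and [u = g^2 / V], the inequality
      [2 |g x| |g y| <= g x ^ 2 / V x * V y + g y ^ 2 / V y * V x]
    gives [<g, P g> <= \int g^2 / V * P V], and the drift condition turns this
    into [lambda |g|^2 <= <g, (I - P) g> + b \int_K g^2].

    On [K], the measure [p x] dominates [alpha nu]; if [\int g dnu = 0], then
      [\int (g x - g y)^2 p(x, dy) >= alpha \int (g x - g y)^2 nu(dy)
                                   >= alpha (g x)^2],
    and integrating over [x] gives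
    [alpha \int_K g^2 <= 2 <g, (I - P) g>].

    Both bounds are applied to [g = f - \int f dnu]: the shift leaves the
    Dirichlet form unchanged and increases the norm, since [f] is centered. *)

Set Implicit Arguments.
Unset Strict Implicit.
Unset Printing Implicit Defensive.

Import Order.TTheory GRing.Theory Num.Theory.
Import numFieldNormedType.Exports.
Import HBNNSimple.

Local Open Scope classical_set_scope.
Local Open Scope ring_scope.

(** * Integration and measurability preliminaries *)

Section integral_facts.
Context d (T : measurableType d) (R : realType).
Variable mu : {measure set T -> \bar R}.

Lemma integrable_sqr_Lfun2 (f : T -> R) : measurable_fun setT f ->
  (\int[mu]_x (f x ^+ 2)%:E < +oo)%E -> f \in Lfun mu 2%:E.
Proof.
move=> mf f2; rewrite inE; apply/andP; split; rewrite inE//=.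
rewrite /finite_norm unlock poweR_lty//.
apply: le_lt_trans f2; rewrite le_eqVlt; apply/orP; left; apply/eqP.
apply: eq_integral => x _ /=.
by rewrite powR_mulrn// real_normK// num_real.
Qed.

Lemma cvg_ge0_integral (f : (T -> \bar R)^nat) (g : T -> \bar R) :
  (forall n, measurable_fun setT (f n)) -> (forall n x, 0 <= f n x)%E ->
  (forall x, nondecreasing_seq (f ^~ x)) ->
  (forall x, f n x @[n --> \oo] --> g x) ->
  (\int[mu]_x f n x)%E @[n --> \oo] --> (\int[mu]_x g x)%E.
Proof.
move=> mf f0 ndf fg.
rewrite [X in _ --> X](_ : _ = (\int[mu]_x (limn (f ^~ x)))%E); last first.
  by apply: eq_integral => x _; apply/esym/cvg_lim => //; exact: fg.
by apply: (@cvg_monotone_convergence _ _ _ mu setT _ f).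
Qed.

End integral_facts.

Lemma integral_probability_cst d (T : measurableType d) (R : realType)
  (mu : probability T R) (r : R) : (\int[mu]_x r%:E)%E = r%:E.
Proof. by rewrite integral_cst//= probability_setT mule1. Qed.

Lemma nnsfun_bounded d (T : measurableType d) (R : realType)
  (h : {nnsfun T >-> R}) : exists2 M : R, 0 <= M & forall x, h x <= M.
Proof.
(* [hM] bounds [h] only by numbers strictly above [M]; hence the choice [|M| + 1], which is also
   nonnegative. *)
have [M [_ hM]] := simple_bounded h; exists (`|M| + 1) => // x.
rewrite (le_trans (ler_norm _))//.
by apply: (hM (`|M| + 1)) => //; rewrite (le_lt_trans (ler_norm M))// ltrDl.
Qed.

Lemma nnsfun_Lfun2 d (T : measurableType d) (R : realType)
  (mu : probability T R) (h : {nnsfun T >-> R}) : (h : T -> R) \in Lfun mu 2%:E.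
Proof.
have mh : measurable_fun setT h by [].
have [M M0 hM] := nnsfun_bounded h.
apply: integrable_sqr_Lfun2 => //.
apply: (@le_lt_trans _ _ (\int[mu]_x (M ^+ 2)%:E)%E); last first.
  by rewrite integral_probability_cst ltry.
apply: ge0_le_integral => //.
- by move=> x _; rewrite lee_fin sqr_ge0.
- by apply/measurable_EFinP; exact: measurable_funX.
- by move=> x _; rewrite lee_fin lerXn2r ?nnegrE.
Qed.

Lemma measurable_fun_inv d (T : measurableType d) (R : realType) (f : T -> R) :
  (forall x, 0 < f x) -> measurable_fun setT f ->
  measurable_fun setT (fun x => (f x)^-1).
Proof.
move=> f0 mf; rewrite (_ : (fun _ => _) = (fun r => r `^ (-1)) \o f).
  exact: (measurableT_comp (measurable_powR _)).
by apply/funext => x /=; rewrite powR_inv1// ltW.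
Qed.

(** Weighted AM-GM: the difference of the two sides is the square [(|a| w - |b| v)^2] divided by
    [v w]. *)
Lemma ler_mul2_weighted (R : realFieldType) (a b v w : R) : 0 < v -> 0 < w ->
  2 * `|a| * `|b| <= a ^+ 2 / v * w + v * (b ^+ 2 / w).
Proof.
move=> v0 w0; rewrite -[a ^+ 2]real_normK ?num_real//.
rewrite -[b ^+ 2]real_normK ?num_real// -subr_ge0.
rewrite (_ : _ - _ = (`|a| * w - `|b| * v) ^+ 2 / (v * w)).
  by rewrite divr_ge0 ?sqr_ge0 ?mulr_ge0 ?ltW.
by field; rewrite !gt_eqF.
Qed.

(** * The kernel on nonnegative functions, and reversibility beyond L^2 *)

Section markov_operator_facts.
Context d (T : measurableType d) (R : realType).
Variable p : R.-pker T ~> T.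
Implicit Types (f g u v : T -> R) (F : T -> \bar R).
Local Notation P := (markov_op_ge0 p).
Local Open Scope ereal_scope.

Lemma markov_op_ge0_ge0 F x : (forall y, 0 <= F y) -> 0 <= P F x.
Proof. by move=> F0; exact: integral_ge0. Qed.

Lemma measurable_markov_op_ge0 F : (forall y, 0 <= F y) ->
  measurable_fun setT F -> measurable_fun setT (P F).
Proof.
move=> F0 mF; apply: measurable_fun_integral_kernel => // U mU.
exact: measurable_kernel.
Qed.

Lemma markov_op_ge0_cst (r : R) x : P (fun=> r%:E) x = r%:E.
Proof. by rewrite /markov_op_ge0 integral_cst// prob_kernel mule1. Qed.

Lemma le_markov_op_ge0 F G x : (forall y, 0 <= F y) ->
  measurable_fun setT F -> measurable_fun setT G ->
  (forall y, F y <= G y) -> P F x <= P G x.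
Proof. by move=> F0 mF mG FG; exact: ge0_le_integral. Qed.

Lemma markov_op_ge0_nnsfun_fin (h : {nnsfun T >-> R}) x :
  P (EFin \o h) x \is a fin_num.
Proof.
rewrite ge0_fin_numE; last by apply: markov_op_ge0_ge0 => y /=; rewrite lee_fin.
have [M _ hM] := nnsfun_bounded h.
rewrite (@le_lt_trans _ _ (P (fun=> M%:E) x))//; last first.
  by rewrite markov_op_ge0_cst ltry.
apply: le_markov_op_ge0 => [y||//|y] /=; rewrite ?lee_fin//.
exact/measurable_EFinP.
Qed.

Lemma measurable_markov_op g :
  measurable_fun setT g -> measurable_fun setT (markov_op p g).
Proof.
move=> mg; have mEg : measurable_fun setT (EFin \o g) by exact/measurable_EFinP.
rewrite (_ : markov_op p g =
    fine \o (fun x => P (EFin \o g)^\+ x - P (EFin \o g)^\- x)); last first.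
  by apply/funext => x /=; rewrite /markov_op /Rintegral integralE.
apply: measurableT_comp; first exact: fine_measurable.
by apply: emeasurable_funB; apply: measurable_markov_op_ge0 => //;
  [exact: measurable_funepos|exact: measurable_funeneg].
Qed.

Lemma le_abs_markov_op g x : measurable_fun setT g ->
  `|markov_op p g x|%:E <= P (fun y => `|g y|%:E) x.
Proof.
move=> mg; apply: (@le_trans _ _ `|\int[p x]_y (g y)%:E|).
  rewrite /markov_op /Rintegral.
  (* Where the extended integral is infinite, the real one takes the default value 0 and the bound
     is trivial. *)
  by case: (\int[p x]_y _) => [r||]//=; rewrite normr0 leey.
by apply: le_abse_integral => //; exact/measurable_EFinP.
Qed.

(** Weighted AM-GM for [g x] and [g y] with weights [v x] and [v y], integrated in [y] against
    [p x]. Working with extended reals avoids integrability conditions on [g]. *)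
Lemma abs_mul_markov_op_le g v x :
  measurable_fun setT g -> measurable_fun setT v -> (forall x, 0 < v x)%R ->
  (2 * `|g x * markov_op p g x|)%:E <=
  (g x ^+ 2 / v x)%:E * P (EFin \o v) x +
  (v x)%:E * P (fun y => (g y ^+ 2 / v y)%:E) x.
Proof.
move=> mg mv v0.
have mw : measurable_fun setT (fun y => (g y ^+ 2 / v y)%R).
  apply: measurable_funM; first exact: measurable_funX.
  exact: measurable_fun_inv.
have w0 y : (0 <= g y ^+ 2 / v y)%R by rewrite divr_ge0 ?sqr_ge0 ?ltW.
have v0' y : (0 <= v y)%R by exact: ltW.
have mEw : measurable_fun setT (fun y => (g y ^+ 2 / v y)%:E).
  exact/measurable_EFinP.
have mEv : measurable_fun setT (EFin \o v) by exact/measurable_EFinP.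
have mEg : measurable_fun setT (fun y => `|g y|%:E).
  by apply/measurable_EFinP; exact: measurableT_comp.
rewrite normrM mulrA EFinM.
apply: (@le_trans _ _ ((2 * `|g x|)%:E * P (fun y => `|g y|%:E) x)).
  by rewrite lee_wpmul2l ?lee_fin ?mulr_ge0// le_abs_markov_op.
rewrite /markov_op_ge0 -!ge0_integralZl//=.
rewrite -ge0_integralD//=.
  apply: ge0_le_integral => //.
  - exact: measurable_funeM.
  - by apply: emeasurable_funD; exact: measurable_funeM.
  - by move=> y _; rewrite -!EFinM -EFinD lee_fin ler_mul2_weighted.
- by move=> y _; rewrite mule_ge0 ?lee_fin.
- exact: measurable_funeM.
- by move=> y _; rewrite mule_ge0 ?lee_fin.
- exact: measurable_funeM.
- by move=> y _; rewrite lee_fin.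
- by rewrite lee_fin.
- by move=> y _; rewrite lee_fin.
- by rewrite lee_fin.
Qed.

Variable pi : probability T R.
Hypothesis rev : reversible p pi.

(** Simple functions are bounded, hence in L^2 of the probability [pi], where reversibility is
    assumed. *)
Lemma reversible_nnsfun (u v : {nnsfun T >-> R}) :
  \int[pi]_x ((u x)%:E * P (EFin \o v) x) =
  \int[pi]_x ((v x)%:E * P (EFin \o u) x).
Proof.
(* Boundedness makes the extended pairing finite, so it agrees with the real-valued [inner]. *)
have bnd (h k : {nnsfun T >-> R}) :
    \int[pi]_x ((h x)%:E * P (EFin \o k) x) =
    (inner pi h (markov_op p k))%:E.
  have eqi : \int[pi]_x ((h x)%:E * P (EFin \o k) x) =
      \int[pi]_x (h x * markov_op p k x)%:E.
    apply: eq_integral => x _; rewrite EFinM; congr *%E.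
    by rewrite /markov_op fineK//; exact: markov_op_ge0_nnsfun_fin.
  rewrite /inner /Rintegral fineK//.
  rewrite ge0_fin_numE; last first.
    apply: integral_ge0 => x _; rewrite lee_fin mulr_ge0//.
    by apply: Rintegral_ge0.
  rewrite -eqi.
  have [M M0 kM] := nnsfun_bounded k.
  have [N N0 hN] := nnsfun_bounded h.
  apply: (@le_lt_trans _ _ (\int[pi]_x (N * M)%:E)); last first.
    by rewrite integral_probability_cst ltry.
  have Pk0 x : 0 <= P (EFin \o k) x.
    by apply: markov_op_ge0_ge0 => y; rewrite lee_fin.
  apply: ge0_le_integral => //.
  - by move=> x _; rewrite mule_ge0// lee_fin.
  - apply: emeasurable_funM; first exact/measurable_EFinP.
    apply: measurable_markov_op_ge0 => [y|]; first by rewrite lee_fin.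
    exact/measurable_EFinP.
  - move=> x _; rewrite EFinM lee_pmul ?lee_fin//.
    rewrite -[leRHS](markov_op_ge0_cst M x).
    apply: le_markov_op_ge0 => [y||//|y] /=; rewrite ?lee_fin//.
    exact/measurable_EFinP.
rewrite !bnd; congr EFin; rewrite rev; [|exact: nnsfun_Lfun2..].
by rewrite /inner; apply: eq_Rintegral => x _; rewrite mulrC.
Qed.

(** Monotone convergence twice: under [p x] for the inner integral, then under [pi]. *)
Lemma cvg_integral_mulr_markov_op_ge0 (w : T -> R) (f : (T -> R)^nat) g :
  measurable_fun setT w -> (forall x, 0 <= w x)%R ->
  (forall n, measurable_fun setT (f n)) -> (forall n x, 0 <= f n x)%R ->
  (forall x, nondecreasing_seq (f ^~ x)) ->
  (forall x, (f n x)%:E @[n --> \oo] --> (g x)%:E) ->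
  \int[pi]_x ((w x)%:E * P (EFin \o f n) x) @[n --> \oo] -->
  \int[pi]_x ((w x)%:E * P (EFin \o g) x).
Proof.
move=> mw w0 mf f0 ndf fg.
have Pf0 n x : 0 <= P (EFin \o f n) x.
  by apply: markov_op_ge0_ge0 => y; rewrite lee_fin.
apply: cvg_ge0_integral => [n|n x|x m n mn|x].
- apply: emeasurable_funM; first exact/measurable_EFinP.
  apply: measurable_markov_op_ge0 => [y|]; first by rewrite lee_fin.
  exact/measurable_EFinP.
- by rewrite mule_ge0// lee_fin.
- rewrite lee_wpmul2l ?lee_fin//; apply: le_markov_op_ge0 => [y| | |y] /=.
  + by rewrite lee_fin.
  + exact/measurable_EFinP.
  + exact/measurable_EFinP.
  + by rewrite lee_fin ndf.
- apply: cvgeZl => //; apply: cvg_ge0_integral => //= n.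
  exact/measurable_EFinP.
Qed.

(** Here [P w] is fixed, so one monotone convergence under [pi] suffices; finiteness of [P w] lets
    it pass through the pointwise limit as a factor. *)
Lemma cvg_integral_mull_markov_op_ge0 (w : T -> R) (f : (T -> R)^nat) g :
  measurable_fun setT w -> (forall x, 0 <= w x)%R ->
  (forall x, P (EFin \o w) x < +oo) ->
  (forall n, measurable_fun setT (f n)) -> (forall n x, 0 <= f n x)%R ->
  (forall x, nondecreasing_seq (f ^~ x)) ->
  (forall x, (f n x)%:E @[n --> \oo] --> (g x)%:E) ->
  \int[pi]_x ((f n x)%:E * P (EFin \o w) x) @[n --> \oo] -->
  \int[pi]_x ((g x)%:E * P (EFin \o w) x).
Proof.
move=> mw w0 Pwoo mf f0 ndf fg.
have Pw0 x : 0 <= P (EFin \o w) x.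
  by apply: markov_op_ge0_ge0 => y; rewrite lee_fin.
apply: cvg_ge0_integral => [n|n x|x m n mn|x].
- apply: emeasurable_funM; first exact/measurable_EFinP.
  apply: measurable_markov_op_ge0 => [y|]; first by rewrite lee_fin.
  exact/measurable_EFinP.
- by rewrite mule_ge0// lee_fin.
- by rewrite lee_wpmul2r ?lee_fin ?ndf.
- by apply: cvgeZr; rewrite ?ge0_fin_numE.
Qed.

(** Extension from simple functions by increasing approximation, one argument at a time: first [v]
    with the other function simple, then [u]. *)
Lemma reversible_ge0 u v :
  measurable_fun setT u -> (forall x, 0 <= u x)%R ->
  measurable_fun setT v -> (forall x, 0 <= v x)%R ->
  (forall x, P (EFin \o v) x < +oo) ->
  \int[pi]_x ((u x)%:E * P (EFin \o v) x) =
  \int[pi]_x ((v x)%:E * P (EFin \o u) x).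
Proof.
move=> mu u0 mv v0 Pvoo.
have mEu : measurable_fun setT (EFin \o u) by exact/measurable_EFinP.
have mEv : measurable_fun setT (EFin \o v) by exact/measurable_EFinP.
pose U := nnsfun_approx measurableT mEu.
pose V := nnsfun_approx measurableT mEv.
have ndU x : nondecreasing_seq (fun n => U n x).
  by move=> m n mn; exact/lefP/nd_nnsfun_approx.
have ndV x : nondecreasing_seq (fun n => V n x).
  by move=> m n mn; exact/lefP/nd_nnsfun_approx.
have cU x : (U n x)%:E @[n --> \oo] --> (u x)%:E.
  by apply: (cvg_nnsfun_approx measurableT mEu) => // y _; rewrite lee_fin.
have cV x : (V n x)%:E @[n --> \oo] --> (v x)%:E.
  by apply: (cvg_nnsfun_approx measurableT mEv) => // y _; rewrite lee_fin.
(* For simple [h], [P h] is finite, so both sides are limits along the approximations [V n] of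
   [v]. *)
have simple (h : {nnsfun T >-> R}) :
    \int[pi]_x ((h x)%:E * P (EFin \o v) x) =
    \int[pi]_x ((v x)%:E * P (EFin \o h) x).
  have h0 x : (0 <= h x)%R by [].
  have c1 : \int[pi]_x ((h x)%:E * P (EFin \o V n) x) @[n --> \oo] -->
      \int[pi]_x ((h x)%:E * P (EFin \o v) x).
    exact: cvg_integral_mulr_markov_op_ge0.
  have c2 : \int[pi]_x ((V n x)%:E * P (EFin \o h) x) @[n --> \oo] -->
      \int[pi]_x ((v x)%:E * P (EFin \o h) x).
    apply: cvg_integral_mull_markov_op_ge0 => // x.
    by rewrite ltey_eq markov_op_ge0_nnsfun_fin.
  rewrite -(cvg_lim _ c2)//; apply/esym/cvg_lim => //.
  under eq_fun do rewrite -reversible_nnsfun.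
  exact: c1.
have c1 : \int[pi]_x ((v x)%:E * P (EFin \o U n) x) @[n --> \oo] -->
    \int[pi]_x ((v x)%:E * P (EFin \o u) x).
  exact: cvg_integral_mulr_markov_op_ge0.
have c2 : \int[pi]_x ((U n x)%:E * P (EFin \o v) x) @[n --> \oo] -->
    \int[pi]_x ((u x)%:E * P (EFin \o v) x).
  exact: cvg_integral_mull_markov_op_ge0.
rewrite -(cvg_lim _ c2)//; apply/cvg_lim => //.
under eq_fun do rewrite simple.
exact: c1.
Qed.

(** Reversibility gives the two terms of the pointwise bound [abs_mul_markov_op_le] the same
    integral, which absorbs the factor 2. *)
Lemma integral_abs_mul_markov_op_le g v :
  measurable_fun setT g -> measurable_fun setT v -> (forall x, 0 < v x)%R ->
  (forall x, P (EFin \o v) x < +oo) ->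
  \int[pi]_x `|g x * markov_op p g x|%:E <=
  \int[pi]_x ((g x ^+ 2 / v x)%:E * P (EFin \o v) x).
Proof.
move=> mg mv v0 Pvoo.
have mw : measurable_fun setT (fun y => (g y ^+ 2 / v y)%R) 
  by apply: measurable_funM; [exact: measurable_funX|exact: measurable_fun_inv].
have w0 y : (0 <= g y ^+ 2 / v y)%R by rewrite divr_ge0 ?sqr_ge0 ?ltW.
have v0' y : (0 <= v y)%R by exact: ltW.
have mPv : measurable_fun setT (P (EFin \o v)).
  apply: measurable_markov_op_ge0 => [y|]; first by rewrite lee_fin.
  exact/measurable_EFinP.
have mPw : measurable_fun setT (P (fun y => (g y ^+ 2 / v y)%:E)).
  apply: measurable_markov_op_ge0 => [y|]; first by rewrite lee_fin.
  exact/measurable_EFinP.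
have m1 : measurable_fun setT (fun x => `|g x * markov_op p g x|%:E).
  apply/measurable_EFinP/measurableT_comp => //.
  by apply: measurable_funM => //; exact: measurable_markov_op.
have Pv0 x : 0 <= P (EFin \o v) x.
  by apply: markov_op_ge0_ge0 => y; rewrite lee_fin.
have Pw0 x : 0 <= P (fun y => (g y ^+ 2 / v y)%:E) x.
  by apply: markov_op_ge0_ge0 => y; rewrite lee_fin.
rewrite -(@lee_pmul2l _ 2%:E)// -ge0_integralZl//.
have -> : 2%:E * \int[pi]_x ((g x ^+ 2 / v x)%:E * P (EFin \o v) x) =
    \int[pi]_x ((g x ^+ 2 / v x)%:E * P (EFin \o v) x +
                (v x)%:E * P (fun y => (g y ^+ 2 / v y)%:E) x).
  rewrite ge0_integralD//.
  - rewrite -(reversible_ge0 mw w0 mv v0' Pvoo).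
    by rewrite (_ : 2%:E = 1 + 1)// ge0_muleDl// mul1e.
  - by move=> x _; rewrite mule_ge0 ?lee_fin.
  - by apply: emeasurable_funM => //; exact/measurable_EFinP.
  - by move=> x _; rewrite mule_ge0 ?lee_fin.
  - by apply: emeasurable_funM => //; exact/measurable_EFinP.
apply: ge0_le_integral => //.
- by apply: emeasurable_funM => //; exact/measurable_EFinP.
- by apply: emeasurable_funD; apply: emeasurable_funM => //;
    exact/measurable_EFinP.
- by move=> x _; rewrite -EFinM abs_mul_markov_op_le.
Qed.
End markov_operator_facts.

(** * Square integrable functions under a measure of mass one *)

(* Applied to [p x], which does not have type [probability T R]. *)
Section unit_mass.
Context d (T : measurableType d) (R : realType).
Variable mu : {measure set T -> \bar R}.
Hypothesis mu1 : mu setT = 1%E.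
Variable f : T -> R.
Hypothesis mf : measurable_fun setT f.
Hypothesis f2 : (\int[mu]_x (f x ^+ 2)%:E < +oo)%E.

Lemma integrable_sqr : mu.-integrable setT (EFin \o (fun x => f x ^+ 2)).
Proof.
apply/integrableP; split; first exact/measurable_EFinP/measurable_funX.
by under eq_integral do rewrite gee0_abs ?lee_fin ?sqr_ge0//.
Qed.

Lemma sqr_integrable : mu.-integrable setT (EFin \o f).
Proof.
apply/Lfun1_integrable; apply: Lfun_subset12; first by rewrite mu1.
exact: integrable_sqr_Lfun2.
Qed.

Lemma integrable_unit_cst (c : R) : mu.-integrable setT (EFin \o (fun=> c)).
Proof.
apply: measurable_bounded_integrable => //; first by rewrite mu1 ltry.
by exists `|c|; split; [rewrite num_real|move=> y cy x _; exact: ltW].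
Qed.

Lemma Rintegral_unit_cst (c : R) : \int[mu]_x c = c.
Proof. by rewrite Rintegral_cst// mu1 mulr1. Qed.

Lemma Rintegral_subr (c : R) : \int[mu]_x (f x - c) = \int[mu]_x f x - c.
Proof.
rewrite RintegralB//; last exact: integrable_unit_cst.
  by rewrite Rintegral_unit_cst.
exact: sqr_integrable.
Qed.

Lemma integral_sqr_subl (c : R) : (\int[mu]_x ((c - f x) ^+ 2)%:E)%E =
  (c ^+ 2 - 2 * c * (\int[mu]_x f x) + \int[mu]_x (f x ^+ 2))%:E.
Proof.
have integrable_scale : mu.-integrable setT (EFin \o (fun x => 2 * c * f x)).
  exact: (integrableZl measurableT (2 * c) sqr_integrable).
have i1 : mu.-integrable setT (EFin \o (fun x => c ^+ 2 - 2 * c * f x)).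
  exact: (integrableB measurableT (integrable_unit_cst _) integrable_scale).
have i2 := integrable_sqr.
rewrite -(@fineK _ (\int[mu]_x _)%E); last first.
  apply: integrable_fin_num => //.
  apply: eq_integrable (integrableD measurableT i1 i2) => // x _.
  by rewrite /= -EFinD; congr EFin; ring.
congr EFin; rewrite -/(Rintegral _ _ _).
transitivity (\int[mu]_x (c ^+ 2 - 2 * c * f x + f x ^+ 2)).
  by apply: eq_Rintegral => x _; ring.
rewrite RintegralD// RintegralB//; last exact: integrable_unit_cst.
by rewrite RintegralZl// ?Rintegral_unit_cst//; exact: sqr_integrable.
Qed.

End unit_mass.

(** * Invariance, integrability and shifts for a reversible operator *)

Section reversible_markov_operator.
Context d (T : measurableType d) (R : realType).
Variable p : R.-pker T ~> T.
Implicit Types (f g u v : T -> R) (F : T -> \bar R).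
Local Notation P := (markov_op_ge0 p).
Variable pi : probability T R.
Hypothesis rev : reversible p pi.

(** Invariance of [pi] in integrated form: symmetry against the constant 1, which [P] fixes. *)
Lemma integral_markov_op_ge0 u :
  measurable_fun setT u -> (forall x, 0 <= u x) ->
  (\int[pi]_x P (EFin \o u) x = \int[pi]_x (u x)%:E)%E.
Proof.
move=> mu u0.
transitivity (\int[pi]_x (1%:E * P (EFin \o u) x))%E.
  by apply: eq_integral => x _; rewrite mul1e.
rewrite -(reversible_ge0 rev mu u0 (v := cst 1))//; last first.
  by move=> x; rewrite markov_op_ge0_cst ltry.
by apply: eq_integral => x _; rewrite markov_op_ge0_cst mule1.
Qed.

Section square_integrable.
Variable g : T -> R.
Hypothesis mg : measurable_fun setT g.
Hypothesis g2 : (\int[pi]_x (g x ^+ 2)%:E < +oo)%E.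

(** With weight [v = 1], the bound [integral_abs_mul_markov_op_le] has the finite right-hand side
    [\int g^2]. *)
Lemma integrable_mul_markov_op :
  pi.-integrable setT (EFin \o (fun x => g x * markov_op p g x)).
Proof.
apply/integrableP; split.
  by apply/measurable_EFinP/measurable_funM => //; exact: measurable_markov_op.
apply: (@le_lt_trans _ _ (\int[pi]_x ((g x ^+ 2 / 1)%:E * P (fun=> 1%:E) x))%E).
  apply: (integral_abs_mul_markov_op_le rev mg (v := cst 1)) => // x.
  by rewrite markov_op_ge0_cst ltry.
by under eq_integral do rewrite markov_op_ge0_cst mule1 divr1.
Qed.

Lemma integrable_markov_op_sqr :
  pi.-integrable setT (P (fun y => (g y ^+ 2)%:E)).
Proof.
have P0 x : (0 <= P (fun y => (g y ^+ 2)%:E) x)%E.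
  by apply: markov_op_ge0_ge0 => y; rewrite lee_fin sqr_ge0.
apply/integrableP; split.
  apply: measurable_markov_op_ge0 => [y|]; first by rewrite lee_fin sqr_ge0.
  by apply/measurable_EFinP; exact: measurable_funX.
under eq_integral do rewrite gee0_abs//.
rewrite (integral_markov_op_ge0 (u := fun x => g x ^+ 2))// => [|x]; last first.
  exact: sqr_ge0.
exact: measurable_funX.
Qed.

(** [P (g^2)] has finite [pi]-integral, hence is finite almost everywhere; at such [x], [g] is
    square integrable and so integrable under [p x], and linearity applies. *)
Lemma ae_markov_op_subr (c : R) :
  {ae pi, forall x, markov_op p (fun y => g y - c) x = markov_op p g x - c}.
Proof.
have := integrable_ae measurableT integrable_markov_op_sqr.
apply: filterS => x /(_ Logic.I) fx.
apply: Rintegral_subr => //; first exact: prob_kernel.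
by rewrite ltey_eq fx.
Qed.

Lemma integrable_markov_op : pi.-integrable setT (EFin \o markov_op p g).
Proof.
have mng : measurable_fun setT (Num.norm \o g) by exact: measurableT_comp.
have mPg := measurable_markov_op p mg.
apply/integrableP; split; first exact/measurable_EFinP.
apply: (@le_lt_trans _ _ (\int[pi]_x P (EFin \o (Num.norm \o g)) x)%E).
  apply: ge0_le_integral => //.
  - by do 2 apply: measurableT_comp => //.
  - apply: measurable_markov_op_ge0 => [y|]; first by rewrite lee_fin/=.
    exact/measurable_EFinP.
  - by move=> x _; exact: le_abs_markov_op.
rewrite integral_markov_op_ge0//; last by move=> x /=.
by have /integrableP[] := sqr_integrable (probability_setT pi) mg g2.
Qed.

Lemma Rintegral_markov_op : \int[pi]_x markov_op p g x = \int[pi]_x g x.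
Proof.
have gL : g \in Lfun pi 2%:E by exact: integrable_sqr_Lfun2.
have := rev (Lfun_cst pi 1 2) gL.
rewrite /inner; under eq_Rintegral do rewrite mul1r.
move=> ->; apply: eq_Rintegral => x _.
by rewrite /markov_op Rintegral_unit_cst ?mul1r//; exact: prob_kernel.
Qed.

End square_integrable.
End reversible_markov_operator.

(** * Consequences of the drift and minorization conditions *)

Section drift_and_minorization.
Context d (T : measurableType d) (R : realType).
Variable p : R.-pker T ~> T.
Local Notation P := (markov_op_ge0 p).
Variable pi : probability T R.
Hypothesis rev : reversible p pi.
Variable K : set T.
Hypothesis mK : measurable K.

Section square_integrable.
Variable g : T -> R.
Hypothesis mg : measurable_fun setT g.
Hypothesis g2 : (\int[pi]_x (g x ^+ 2)%:E < +oo)%E.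

Let ig2 : pi.-integrable setT (EFin \o (fun x => g x ^+ 2)).
Proof. exact: integrable_sqr. Qed.

Lemma integrable_indic_sqr :
  pi.-integrable setT (EFin \o (fun x => \1_K x * g x ^+ 2)).
Proof.
apply: le_integrable ig2 => //.
  by apply/measurable_EFinP/measurable_funM => //; exact: measurable_funX.
move=> x _ /=; rewrite lee_fin normrM ler_piMl//.
by rewrite indicE; case: (x \in K); rewrite ?normr1 ?normr0.
Qed.

Variable V : T -> R.
Hypothesis mV : measurable_fun setT V.
Hypothesis V_ge1 : forall x, 1 <= V x.

Let V0 x : 0 < V x. Proof. exact: lt_le_trans (V_ge1 x). Qed.

Let indic_div_sqr_ge0 x : 0 <= \1_K x * (g x ^+ 2 / V x).
Proof. by rewrite mulr_ge0// divr_ge0 ?sqr_ge0 ?ltW. Qed.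

Let indic_div_sqr_le x : \1_K x * (g x ^+ 2 / V x) <= \1_K x * g x ^+ 2.
Proof. by rewrite ler_wpM2l// ler_piMr ?sqr_ge0// invf_le1. Qed.

Lemma integrable_indic_div_sqr :
  pi.-integrable setT (EFin \o (fun x => \1_K x * (g x ^+ 2 / V x))).
Proof.
apply: le_integrable integrable_indic_sqr => //.
  apply/measurable_EFinP/measurable_funM => //; apply: measurable_funM.
    exact: measurable_funX.
  exact: measurable_fun_inv.
by move=> x _; rewrite lee_fin !ger0_norm// (le_trans (indic_div_sqr_ge0 x)).
Qed.

Lemma Rintegral_indic_div_sqr_ge0 :
  0 <= \int[pi]_x (\1_K x * (g x ^+ 2 / V x)).
Proof. by apply: Rintegral_ge0 => x _. Qed.

Lemma Rintegral_indic_div_sqr_le :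
  \int[pi]_x (\1_K x * (g x ^+ 2 / V x)) <= \int[pi]_x (\1_K x * g x ^+ 2).
Proof.
apply: le_Rintegral => //; [exact: integrable_indic_div_sqr|].
exact: integrable_indic_sqr.
Qed.

(** Take [v = V] in [integral_abs_mul_markov_op_le] and insert the drift condition into
    [g^2 / V * P V]. The term on [K] keeps its factor [1 / V]: replacing it by 1 would require
    [0 <= b], and the sign of [b] is itself deduced from this bound. *)
Lemma drift_bound (b lambda : R) :
  (forall x, (P (EFin \o V) x <= ((1 - lambda) * V x + b * \1_K x)%:E)%E) ->
  inner pi g (markov_op p g) <=
    (1 - lambda) * normsq pi g + b * \int[pi]_x (\1_K x * (g x ^+ 2 / V x)).
Proof.
move=> drift.
have mw : measurable_fun setT (fun x => g x ^+ 2 / V x).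
  by apply: measurable_funM; [exact: measurable_funX|exact: measurable_fun_inv].
have iKw := integrable_indic_div_sqr.
have i1 := integrableZl measurableT (1 - lambda) ig2.
have i2 := integrableZl measurableT b iKw.
have i12 := integrableD measurableT i1 i2.
rewrite /normsq /inner.
under [X in _ <= _ * X + _]eq_Rintegral do rewrite -expr2.
rewrite -[X in _ <= X + _](RintegralZl (1 - lambda) measurableT ig2).
rewrite -[X in _ <= _ + X](RintegralZl b measurableT iKw).
rewrite -(RintegralD measurableT i1 i2).
rewrite -lee_fin /Rintegral !fineK ?integrable_fin_num//; last first.
  exact: integrable_mul_markov_op.
apply: (@le_trans _ _ (\int[pi]_x `|g x * markov_op p g x|%:E)%E).
  apply: le_integral => //.
  - exact: integrable_mul_markov_op.
  - by have /integrable_norm := integrable_mul_markov_op rev mg g2.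
  - by move=> x _; rewrite lee_fin ler_norm.
apply: le_trans.
  (* The drift condition makes [P V] finite at every point. *)
  apply: (integral_abs_mul_markov_op_le rev mg mV V0) => x.
  by rewrite (le_lt_trans (drift x))// ltry.
have w0 x : 0 <= g x ^+ 2 / V x by rewrite divr_ge0 ?sqr_ge0 ?ltW.
have PV0 x : (0 <= P (EFin \o V) x)%E.
  by apply: markov_op_ge0_ge0 => y; rewrite lee_fin ltW.
apply: ge0_le_integral => //.
- by move=> x _; rewrite mule_ge0 ?lee_fin.
- apply: emeasurable_funM; first exact/measurable_EFinP.
  apply: measurable_markov_op_ge0 => [y|]; first by rewrite lee_fin ltW.
  exact/measurable_EFinP.
- exact: (measurable_int pi).
- move=> x _.
  apply: le_trans (lee_wpmul2l _ (drift x)) _; first by rewrite lee_fin.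
  rewrite -EFinM lee_fin le_eqVlt; apply/orP; left; apply/eqP.
  by field; rewrite gt_eqF.
Qed.

End square_integrable.

(* Applied to the constant function [1], the drift bound reads
   [lambda <= b * \int_K V^-1], which forces both signs. *)
Lemma drift_positive (V : T -> R) (b lambda : R) :
  measurable_fun setT V -> (forall x, 1 <= V x) ->
  (forall x, (P (EFin \o V) x <= ((1 - lambda) * V x + b * \1_K x)%:E)%E) ->
  0 < lambda -> 0 < b /\ (0 < pi K)%E.
Proof.
move=> mV V_ge1 drift lambda_gt0; have pi1 := probability_setT pi.
have m1 : measurable_fun setT (cst 1 : T -> R) by exact: measurable_cst.
have one2 : (\int[pi]_x (cst (1 : R) x ^+ 2)%:E < +oo)%E.
  under eq_integral do rewrite /= expr1n.
  by rewrite integral_probability_cst ltry.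
have one_P : inner pi (cst 1) (markov_op p (cst 1)) = 1.
  rewrite -[RHS](Rintegral_unit_cst pi1); apply: eq_Rintegral => x _.
  by rewrite /markov_op Rintegral_unit_cst ?mul1r//; exact: prob_kernel.
have one_norm : normsq pi (cst 1) = 1.
  rewrite -[RHS](Rintegral_unit_cst pi1); apply: eq_Rintegral => x _.
  by rewrite mul1r.
have := drift_bound m1 one2 mV V_ge1 drift.
rewrite one_P one_norm mulr1.
have := Rintegral_indic_div_sqr_le m1 one2 mV V_ge1.
have := Rintegral_indic_div_sqr_ge0 (cst 1) V_ge1.
set c := \int[pi]_x _ => c0 cK bc.
(* The drift bound now reads [1 <= 1 - lambda + b * c]. *)
have bc0 : 0 < b * c by lra.
have b0 : 0 < b.
  by rewrite ltNge; apply/negP => b0; have := mulr_le0_ge0 b0 c0; lra.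
split => //; rewrite lt_neqAle measure_ge0 andbT; apply/eqP => piK0.
(* If [pi K = 0], then [c <= \int 1_K = 0], against [0 < c]. *)
have : 0 < c by rewrite -(pmulr_rgt0 _ b0).
move=> /lt_le_trans => /(_ _ cK); rewrite /Rintegral.
under eq_integral do rewrite /= expr1n mulr1.
rewrite [X in fine X](_ : _ = 0%E) ?ltxx//.
by rewrite integral_indic// setIT.
Qed.

Section minorization.
Variables (alpha : R) (nu : probability T R).
Hypothesis alpha0 : 0 <= alpha.
Hypothesis minorization : forall x A, measurable A ->
  (alpha%:E * nu A * (\1_K x)%:E <= P (EFin \o \1_A) x)%E.

(** On sets, the hypothesis says that [p x] dominates the scaled measure [alpha 1_K(x) nu];
    domination of measures passes to integrals of nonnegative functions. *)
Lemma minorization_ge0 (F : T -> \bar R) x : (forall y, 0 <= F y)%E ->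
  measurable_fun setT F ->
  ((alpha * \1_K x)%:E * \int[nu]_y F y <= P F x)%E.
Proof.
move=> F0 mF.
have a0 : 0 <= alpha * \1_K x by rewrite mulr_ge0.
rewrite -[X in (X%:E * _)%E]/((NngNum a0)%:num) -ge0_integral_mscale//.
apply: ge0_le_measure_integral => // A mA.
have := minorization x mA.
rewrite /markov_op_ge0 integral_indic// setIT; apply: le_trans.
rewrite [leLHS](_ : _ = (alpha * \1_K x)%:E * nu A)%E//.
by rewrite EFinM -muleA (muleC (\1_K x)%:E) muleA.
Qed.

(** This gives meaning to means under [nu]. If [\int g^2 dnu] were infinite, [P (g^2)] would be
    infinite on [K], a set of positive [pi]-measure, whereas its [pi]-integral is [\int g^2 dpi]. *)
Lemma minorization_sqr_lty (g : T -> R) : measurable_fun setT g ->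
  (\int[pi]_x (g x ^+ 2)%:E < +oo)%E -> 0 < alpha -> (0 < pi K)%E ->
  (\int[nu]_x (g x ^+ 2)%:E < +oo)%E.
Proof.
move=> mg g2 alpha_gt0 piK.
have mg2 : measurable_fun setT (fun y => (g y ^+ 2)%:E).
  by apply/measurable_EFinP; exact: measurable_funX.
have g20 y : (0 <= (g y ^+ 2)%:E)%E by rewrite lee_fin sqr_ge0.
have mPg2 := measurable_markov_op_ge0 p g20 mg2.
rewrite ltNge leye_eq; apply/negP => /eqP nuoo.
have : (\int[pi]_x ((\1_K x)%:E * +oo) <=
        \int[pi]_x P (fun y => (g y ^+ 2)%:E) x)%E.
  apply: ge0_le_integral => //.
  - by apply: emeasurable_funM => //; apply/measurable_EFinP.
  - move=> x _; apply: le_trans (minorization_ge0 x g20 mg2).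
    rewrite nuoo indicE; case: (x \in K); rewrite ?mulr1 ?mulr0 ?mul0e// mul1e.
    by rewrite gt0_muley ?lte_fin.
rewrite (integral_markov_op_ge0 rev (u := fun y => g y ^+ 2))//; last first.
  exact: measurable_funX.
rewrite ge0_integralZr//; last exact/measurable_EFinP.
rewrite integral_indic// setIT gt0_muley// leye_eq => /eqP g2oo.
by rewrite g2oo in g2.
Qed.

Variable g : T -> R.
Hypothesis mg : measurable_fun setT g.
Hypothesis g2 : (\int[pi]_x (g x ^+ 2)%:E < +oo)%E.
Hypothesis nug2 : (\int[nu]_x (g x ^+ 2)%:E < +oo)%E.
Hypothesis nug : \int[nu]_x g x = 0.

(** Expand [(g x - g y)^2] under both [nu] and [p x]. The cross term under [nu] vanishes by [nug],
    and the term with [\int g^2 dnu] is nonnegative and dropped. *)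
Lemma minorization_pointwise x :
  ((alpha * (\1_K x * g x ^+ 2) + 2 * (g x * markov_op p g x))%:E <=
   (g x ^+ 2)%:E + P (fun y => (g y ^+ 2)%:E) x)%E.
Proof.
(* The expansion under [p x] needs [P (g^2) x] finite; otherwise the right-hand side is infinite. *)
have [Poo|Pfin] := eqVneq (P (fun y => (g y ^+ 2)%:E) x) +oo%E.
  by rewrite Poo addey// leey.
have Plty : (P (fun y => (g y ^+ 2)%:E) x < +oo)%E by rewrite ltey.
have mc : measurable_fun setT (fun y => ((g x - g y) ^+ 2)%:E).
  by apply/measurable_EFinP; apply: measurable_funX; exact: measurable_funB.
have c0 y : (0 <= ((g x - g y) ^+ 2)%:E)%E by rewrite lee_fin sqr_ge0.
have := minorization_ge0 x c0 mc.
rewrite integral_sqr_subl//; last exact: probability_setT.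
rewrite /markov_op_ge0 integral_sqr_subl//; last exact: prob_kernel.
rewrite nug mulr0 subr0 -EFinM lee_fin => le1.
rewrite -(@fineK _ (\int[p x]_y _)%E); last first.
  by rewrite ge0_fin_numE// integral_ge0// => y _; rewrite lee_fin sqr_ge0.
rewrite -EFinD lee_fin -/(Rintegral _ _ _) -/(markov_op p g x).
have nu0 : 0 <= \int[nu]_y (g y ^+ 2).
  by apply: Rintegral_ge0 => y _; exact: sqr_ge0.
have a0 : 0 <= alpha * \1_K x * \int[nu]_y (g y ^+ 2) by rewrite !mulr_ge0.
move: le1; rewrite -/(markov_op p g x); lra.
Qed.

(** The pointwise bound integrated over [pi]: by invariance [P (g^2)] and [g^2] each contribute
    [normsq pi g]. *)
Lemma minorization_bound :
  alpha * \int[pi]_x (\1_K x * g x ^+ 2) + 2 * inner pi g (markov_op p g) <=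
  2 * normsq pi g.
Proof.
have ig2 := integrable_sqr mg g2.
have iP := integrable_markov_op_sqr rev mg g2.
have iK := integrable_indic_sqr mg g2.
have im := integrable_mul_markov_op rev mg g2.
have i1 := integrableZl measurableT alpha iK.
have i2 := integrableZl measurableT 2 im.
have i12 := integrableD measurableT i1 i2.
rewrite -[X in X + _ <= _](RintegralZl alpha measurableT iK).
rewrite -[X in _ + X <= _](RintegralZl 2 measurableT im).
rewrite -(RintegralD measurableT i1 i2).
have nE : (\int[pi]_x (g x ^+ 2)%:E)%E = (normsq pi g)%:E.
  rewrite /normsq /inner; under [in RHS]eq_Rintegral do rewrite -expr2.
  by rewrite fineK// integrable_fin_num.
rewrite -lee_fin /Rintegral fineK ?integrable_fin_num//.
have -> : ((2 * normsq pi g)%:E =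
    \int[pi]_x ((g x ^+ 2)%:E + P (fun y => (g y ^+ 2)%:E) x))%E.
  rewrite integralD//.
  rewrite (integral_markov_op_ge0 rev (u := fun y => g y ^+ 2))//.
  - by rewrite nE -EFinD -mulr2n mulr_natl.
  - exact: measurable_funX.
  - by move=> x; exact: sqr_ge0.
apply: le_integral => //; first exact: integrableD.
by move=> x _; exact: minorization_pointwise.
Qed.

End minorization.
End drift_and_minorization.

(** * Effect of subtracting a constant from a centered function *)

Section shift.
Context d (T : measurableType d) (R : realType).
Variable p : R.-pker T ~> T.
Variable pi : probability T R.
Hypothesis rev : reversible p pi.
Variable f : T -> R.
Hypothesis mf : measurable_fun setT f.
Hypothesis f2 : (\int[pi]_x (f x ^+ 2)%:E < +oo)%E.
Hypothesis f_mean : \int[pi]_x f x = 0.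
Variable m : R.

Lemma integral_sqr_subr :
  (\int[pi]_x ((f x - m) ^+ 2)%:E = (normsq pi f + m ^+ 2)%:E)%E.
Proof.
under eq_integral do rewrite -[(f _ - m)]opprB sqrrN.
rewrite (integral_sqr_subl (probability_setT pi) mf f2) f_mean mulr0 subr0.
rewrite addrC /normsq /inner.
by under [in RHS]eq_Rintegral do rewrite -expr2.
Qed.

Lemma normsq_subr : normsq pi (fun x => f x - m) = normsq pi f + m ^+ 2.
Proof.
rewrite {1}/normsq /inner; under eq_Rintegral do rewrite -expr2.
by rewrite /Rintegral integral_sqr_subr.
Qed.

(** The cross terms are multiples of [\int f] and [\int P f], both zero. The gain [m ^+ 2] is the
    same as in [normsq_subr], so the Dirichlet form does not change. *)
Lemma inner_markov_op_subr :
  inner pi (fun x => f x - m) (markov_op p (fun x => f x - m)) =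
  inner pi f (markov_op p f) + m ^+ 2.
Proof.
have pi1 := probability_setT pi.
have mg : measurable_fun setT (fun x => f x - m) by exact: measurable_funB.
have mPf := measurable_markov_op p mf.
have i1 := integrable_mul_markov_op rev mf f2.
have i_f := sqr_integrable pi1 mf f2.
have iPf := integrable_markov_op rev mf f2.
have i2 := integrableZl measurableT (- m) i_f.
have i3 := integrableZl measurableT (- m) iPf.
have i4 := integrable_unit_cst pi1 (m ^+ 2).
have i12 := integrableD measurableT i1 i2.
have i34 := integrableD measurableT i3 i4.
transitivity (\int[pi]_x ((f x * markov_op p f x + - m * f x) +
                         (- m * markov_op p f x + m ^+ 2))).
  (* [P (f - m) = P f - m] is available only almost everywhere, so the integrands are compared up to
     a null set. *)
  congr fine; apply: ae_eq_integral => //.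
  - apply/measurable_EFinP/measurable_funM => //; exact: measurable_markov_op.
  - exact: (measurable_int pi (integrableD measurableT i12 i34)).
  - apply: filterS (ae_markov_op_subr rev mf f2 m) => x Px _.
    by rewrite Px; congr EFin; ring.
rewrite (RintegralD measurableT i12 i34) (RintegralD measurableT i1 i2).
rewrite (RintegralD measurableT i3 i4) Rintegral_unit_cst//.
rewrite [X in _ + X + _](RintegralZl (- m) measurableT i_f).
rewrite [X in _ + (X + _)](RintegralZl (- m) measurableT iPf).
by rewrite Rintegral_markov_op// f_mean !mulr0 addr0 add0r.
Qed.

Lemma inner_sub_markov_op :
  inner pi f (fun x => f x - markov_op p f x) =
  normsq pi f - inner pi f (markov_op p f).
Proof.
rewrite /normsq /inner -RintegralB//.
- by apply: eq_Rintegral => x _; rewrite mulrBr.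
- under eq_fun do rewrite /= -expr2.
  exact: integrable_sqr.
- exact: integrable_mul_markov_op.
Qed.

End shift.

(** * The Poincaré inequality from the two bounds *)

Theorem theorem1 (R : realType) (X : ptopologicalType) (polishX : polish R X)
    (p : R.-pker borel X ~> borel X) (pi : probability (borel X) R)
    (pi_inv : unique_invariant p pi) (pi_rev : reversible p pi)
    (V : borel X -> R) (mV : measurable_fun setT V) (V_ge1 : forall x, 1 <= V x)
    (b alpha lambda : R) (alpha_gt0 : 0 < alpha) (lambda_gt0 : 0 < lambda)
    (K : set (borel X)) (mK : measurable K) (nu : probability (borel X) R)
    (drift : forall x : borel X,
      (markov_op_ge0 p (EFin \o V) x
        <= ((1 - lambda) * V x + b * \1_K x)%:E)%E)
    (minorization : forall (x : borel X) (A : set (borel X)), measurable A ->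
      (alpha%:E * nu A * (\1_K x)%:E <= markov_op_ge0 p (EFin \o \1_A) x)%E) :
  let beta_plus := lambda / (1 + 2 * b / alpha) in
  forall f : borel X -> R, L20 pi f ->
    normsq pi f
      <= beta_plus^-1 * inner pi f (fun x => f x - markov_op p f x).
Proof.
move=> beta_plus f [fL2 f_mean].
have mf : measurable_fun setT f.
  by move: fL2; rewrite inE => /andP[/[!inE]].
have f2 : (\int[pi]_x (f x ^+ 2)%:E < +oo)%E.
  exact: (integrable_lty measurableT (Lfun2_integrable_sqr fL2)).
have [b0 piK] := drift_positive pi_rev mK mV V_ge1 drift lambda_gt0.
(* The centering is under [nu], as the minorization bound requires, while [f] itself is centered
   under [pi]. *)
pose m := \int[nu]_x f x.
pose g x := f x - m.
have mg : measurable_fun setT g by exact: measurable_funB.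
have g2 : (\int[pi]_x (g x ^+ 2)%:E < +oo)%E.
  by rewrite /g integral_sqr_subr// ltry.
have nu_sqr_lty (h : borel X -> R) : measurable_fun setT h ->
    (\int[pi]_x (h x ^+ 2)%:E < +oo)%E -> (\int[nu]_x (h x ^+ 2)%:E < +oo)%E.
  move=> mh h2; have a0 := ltW alpha_gt0.
  exact: (minorization_sqr_lty pi_rev mK a0 minorization mh h2).
have nuf2 := nu_sqr_lty f mf f2.
have nug2 := nu_sqr_lty g mg g2.
have nug : \int[nu]_x g x = 0.
  by rewrite Rintegral_subr// ?subrr//; exact: probability_setT.
have := drift_bound pi_rev mK mg g2 mV V_ge1 drift.
have alpha_ge0 := ltW alpha_gt0.
have := minorization_bound pi_rev mK alpha_ge0 minorization mg g2 nug2 nug.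
have := Rintegral_indic_div_sqr_le mK mg g2 mV V_ge1.
rewrite /g inner_markov_op_subr// normsq_subr// inner_sub_markov_op//.
set kK := \int[pi]_x (_ * _ ^+ 2).
set kV := \int[pi]_x (_ * (_ / _)).
set N := normsq pi f; set I := inner pi f _ => kVK hminor hdrift.
(* In [hminor] the shift adds [2 * m ^+ 2] to both sides, which cancels. *)
have kK_le : kK <= 2 / alpha * (N - I).
  by rewrite mulrAC ler_pdivlMr//; lra.
(* With [0 < b] known, the weight [1 / V] can be discarded through [kVK]. *)
have bkV_le : b * kV <= b * (2 / alpha * (N - I)).
  by rewrite ler_pM2l// (le_trans kVK).
have lamN : lambda * N <= (1 + 2 * b / alpha) * (N - I).
  (* The drift bound controls [lambda * (N + m ^+ 2)]; the excess [lambda * m ^+ 2] is dropped. *)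
  have lm : 0 <= lambda * m ^+ 2 by rewrite mulr_ge0 ?sqr_ge0 ?ltW.
  rewrite (_ : _ * (N - I) = N - I + b * (2 / alpha * (N - I))); last by ring.
  by lra.
by rewrite /beta_plus invf_div mulrAC ler_pdivlMr// mulrC.
Qed.
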